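(* Let $d\ge 2$, let $A_0B_0$ and $A_1B_1$ be unit segments in $\mathbb{R}^d$, and let $$\angle(\overrightarrow{A_0B_0},\overrightarrow{A_1B_1})=\theta,\qquad 0\le|\theta|\le\pi.$$ Then there exists a continuous rigid motion transforming $A_0B_0$ into $A_1B_1$ (taking $A_0$ to $A_1$ and $B_0$ to $B_1$) with $L(A_0B_0,A_1B_1)=|\theta|$ if and only if the points $A_0,B_0,A_1,B_1$ are coplanar and $$|A_0B_1|\le 1,\qquad |A_1B_0|\le 1 .$$
   Context: A continuous rigid motion transforming the unit segment $A_0B_0$ into the unit segment $A_1B_1$ is described by the trajectories of its endpoints: continuous curves $A,B:[0,1]\to\mathbb{R}^d$ with $A(0)=A_0$, $B(0)=B_0$, $A(1)=A_1$, $B(1)=B_1$ and $|B(t)-A(t)|=1$ for all $t\in[0,1]$. For such a motion, $L(A_0B_0,A_1B_1):=L(A_0)+L(B_0)$ denotes the sum of the lengths of the two curves $A(t)$ and $B(t)$, $t\in[0,1]$ (so this number depends on the motion). Only motions with $L(A_0B_0,A_1B_1)<\infty$ are considered; after a reparametrization, which does not change lengths, $A(t)$ and $B(t)$ are assumed to be Lipschitz. The angle $\theta$ is a signed angle in $(-\pi,\pi]$ between the vectors $\overrightarrow{A_0B_0}$ and $\overrightarrow{A_1B_1}$; only $|\theta|\in[0,\pi]$, the usual unsigned angle between these vectors, matters here. Points are coplanar if they lie in a common two-dimensional affine plane. $|XY|$ is the Euclidean distance between the points $X$ and $Y$. *)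

(* Defs.v *)
From HB Require Import structures.
From mathcomp Require Import all_boot all_order all_algebra.
From mathcomp Require Import all_classical all_reals all_analysis.

Set Implicit Arguments.
Unset Strict Implicit.
Unset Printing Implicit Defensive.

Import Order.TTheory GRing.Theory Num.Theory.
Import numFieldNormedType.Exports.

Local Open Scope classical_set_scope.
Local Open Scope ring_scope.

(* Points and vectors of R^d are row vectors 'rV[R]_d.  The library norm `|u|
   on them is the sup norm, so the Euclidean structure is set up here. *)
Definition dotp (R : realType) (d : nat) (u v : 'rV[R]_d) : R :=
  \sum_(i < d) u 0 i * v 0 i.

Definition euclid_norm (R : realType) (d : nat) (u : 'rV[R]_d) : R :=
  Num.sqrt (dotp u u).

Definition euclid_dist (R : realType) (d : nat) (X Y : 'rV[R]_d) : R :=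
  euclid_norm (Y - X).

(* Unsigned angle in [0, pi]; meaningful for nonzero u and v. *)
Definition vangle (R : realType) (d : nat) (u v : 'rV[R]_d) : R :=
  acos (dotp u v / (euclid_norm u * euclid_norm v)).

(* The plane is p + rowspace W, the rank condition making it two-dimensional. *)
Definition coplanar (R : realType) (d : nat) (S : set 'rV[R]_d) : Prop :=
  exists (p : 'rV[R]_d) (W : 'M[R]_(2, d)),
    \rank W = 2%N /\ forall X, S X -> (X - p <= W)%MS.

(* Length of the inscribed polygonal line with parameters a :: s. *)
Definition polyline_length (R : realType) (d : nat) (c : R -> 'rV[R]_d)
    (a : R) (s : seq R) : R :=
  \sum_(0 <= i < size s)
    euclid_dist (c (nth a (a :: s) i)) (c (nth a (a :: s) i.+1)).

Definition curve_length (R : realType) (d : nat) (a b : R)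
    (c : R -> 'rV[R]_d) : \bar R :=
  ereal_sup [set (polyline_length c a s)%:E | s in itv_partition a b].

(* A and B are total functions; only their values on [0, 1] matter. *)
Record rigid_motion (R : realType) (d : nat) (A0 B0 A1 B1 : 'rV[R]_d)
    (A B : R -> 'rV[R]_d) : Prop := RigidMotion {
  rigid_motion_contA : {within `[0, 1], continuous A};
  rigid_motion_contB : {within `[0, 1], continuous B};
  rigid_motion_A0 : A 0 = A0;
  rigid_motion_B0 : B 0 = B0;
  rigid_motion_A1 : A 1 = A1;
  rigid_motion_B1 : B 1 = B1;
  rigid_motion_unit : forall t, 0 <= t <= 1 -> euclid_dist (A t) (B t) = 1
}.

Definition motion_length (R : realType) (d : nat) (A B : R -> 'rV[R]_d) :
    \bar R :=
  (curve_length 0 1 A + curve_length 0 1 B)%E.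

(* Main.v *)
(* The direction [D = B - A] moves on the unit sphere from [D0] to [D1], so the
   length of a motion is at least that of [D], hence at least [|theta|].  In the
   case of equality [D] runs monotonically along a great circle, and each small
   displacement of [B] (resp. [- A]) is, up to second order, a fraction of the
   displacement of [D].  Hence, for any vector [w], [<w, B>] increases and [<w, A>]
   decreases wherever [<w, D>] increases; splitting the motion where [D] points
   towards [w] bounds the support function of [B1 - A0] by [1].

   Conversely, the two distance conditions place [B1 - A0] in the lens cut out by
   the unit discs centred at [0] and [D0 + D1].  Boundary points of the lens are
   reached by a turn about one endpoint followed by a turn about the other, and
   interior points by convex combinations of two such motions. *)

Require Import Defs.
From HB Require Import structures.
From mathcomp Require Import all_boot all_order all_algebra.
From mathcomp Require Import all_classical all_reals all_analysis.
From mathcomp Require Import zify ring lra.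

Set Implicit Arguments.
Unset Strict Implicit.
Unset Printing Implicit Defensive.

Import Order.TTheory GRing.Theory Num.Theory.
Import numFieldNormedType.Exports.

Local Open Scope classical_set_scope.
Local Open Scope ring_scope.

(** * Compactness of a segment as an induction principle *)

Section Cousin.
Variable R : realType.

(* Interval form of compactness: the points reachable from [a] have a supremum,
   which the local hypothesis pushes up to [b]. *)
Lemma cousin (P : R -> R -> Prop) (a b : R) : a <= b ->
  (forall s m t, a <= s -> s <= m -> m <= t -> t <= b ->
    P s m -> P m t -> P s t) ->
  (forall x, a <= x <= b -> exists2 e, 0 < e &
    forall s t, a <= s -> s <= x -> x <= t -> t <= b ->
      x - e < s -> t < x + e -> P s t) ->
  P a b.
Proof.
move=> ab Padd Ploc.
pose S := [set t | a <= t <= b /\ P a t].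
have Sa : S a.
  split; first by rewrite lexx.
  have [|e e0 He] := Ploc a; first by rewrite lexx.
  by apply: He => //; lra.
have Sub : ubound S b by move=> t [/andP[]].
have Ssup : has_sup S by split; [exists a | exists b].
have ac : a <= sup S by apply: sup_upper_bound.
have cb : sup S <= b by apply: sup_le_ub => //; exists a.
have [|e e0 He] := Ploc (sup S); first by rewrite ac cb.
have [t [/andP[at_ tb] Pat]] := sup_adherent e0 Ssup => lt_t.
have tc : t <= sup S by apply: sup_upper_bound => //; split => //; apply/andP.
have reach u : sup S <= u -> u <= b -> u < sup S + e -> P a u.
  move=> cu ub ue; apply: (Padd a t u) => //; first exact: le_trans cu.
  exact: He.
have [cb' | cb'] := ltP (sup S) b; last by apply: reach; lra.
have [u [cu ub ue]] : exists u, [/\ sup S < u, u <= b & u < sup S + e].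
  have [h | h] := leP (sup S + e / 2) b.
    by exists (sup S + e / 2); split => //; lra.
  by exists b; split => //; lra.
have : u <= sup S.
  apply: sup_upper_bound => //; split; last by apply: reach => //; exact: ltW.
  by rewrite ub andbT (le_trans ac)// ltW.
by rewrite leNgt cu.
Qed.

End Cousin.

(** * Comparison of chords and arcs on the unit circle *)

Section Trigonometry.
Variable R : realType.
Implicit Types x : R.

Lemma sin_mean_value x : 0 <= x -> exists2 c, 0 <= c <= x & sin x = x * cos c.
Proof.
move=> x0.
have [|c] := @MVT_segment R sin cos 0 x x0 (fun y _ => is_derive_sin y).
  exact/continuous_subspaceT/continuous_sin.
by rewrite in_itv/= sin0 !subr0 mulrC => cx ->; exists c.
Qed.

Lemma sin_sqr_le x : sin x ^+ 2 <= x ^+ 2.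
Proof.
wlog x0 : x / 0 <= x.
  move=> H; have [/H//|x0] := leP 0 x.
  by rewrite -(sqrrN x) -(sqrrN (sin x)) -sinN; apply: H; lra.
have [c _ ->] := sin_mean_value x0.
have c2 : cos c ^+ 2 <= 1 by have := cos2Dsin2 c; nra.
by rewrite exprMn ler_piMr// sqr_ge0.
Qed.

Lemma le_cos x y : 0 <= x -> x <= y -> y <= pi -> cos y <= cos x.
Proof.
by move=> x0 xy ypi; rewrite leNgt ltr_cos -?leNgt// in_itv/=; apply/andP; lra.
Qed.

Lemma cos_half x : cos x = 1 - 2 * sin (x / 2) ^+ 2.
Proof. by rewrite {1}(splitr x) cosD; have := cos2Dsin2 (x / 2); nra. Qed.

Lemma cos_ge_quadratic x : 2 - 2 * cos x <= x ^+ 2.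
Proof. by rewrite cos_half; have := sin_sqr_le (x / 2); nra. Qed.

(** The right side is [4 sin(x/2)^2]. The mean value theorem gives [sin (x / 2) = x / 2 * cos c]
    with [c] between [0] and [x / 2], and [cos c ^+ 2] is at least [cos (x / 2) ^+ 2], hence at
    least [1 - x ^+ 2 / 4]. *)
Lemma cos_le_quartic x : 0 <= x <= pi -> x ^+ 2 - x ^+ 4 / 4 <= 2 - 2 * cos x.
Proof.
move=> /andP[x0 xpi]; rewrite cos_half.
have x20 : 0 <= x / 2 by lra.
have [c /andP[c0 cx] sE] := sin_mean_value x20.
have c1 : cos (x / 2) <= cos c by apply: le_cos => //; lra.
have c2 : 0 <= cos (x / 2) by apply: cos_ge0_pihalf; lra.
have s2 := sin_sqr_le (x / 2).
have cs := cos2Dsin2 (x / 2).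
have h1 : cos (x / 2) ^+ 2 <= cos c ^+ 2 by rewrite ler_sqr ?nnegrE// (le_trans c2).
have h2 : 1 - x ^+ 2 / 4 <= cos c ^+ 2 by nra.
rewrite sE.
have -> : 2 - 2 * (1 - 2 * (x / 2 * cos c) ^+ 2) = x ^+ 2 * cos c ^+ 2 by field.
have -> : x ^+ 2 - x ^+ 4 / 4 = x ^+ 2 * (1 - x ^+ 2 / 4) by field.
by rewrite ler_wpM2l// sqr_ge0.
Qed.

End Trigonometry.

(** * Euclidean inner product and norm on row vectors *)

Section Euclidean.
Variables (R : realType) (d : nat).
Implicit Types u v w : 'rV[R]_d.

Lemma dotpC u v : dotp u v = dotp v u.
Proof. by apply: eq_bigr => i _; rewrite mulrC. Qed.

Lemma dotpDl u v w : dotp (u + v) w = dotp u w + dotp v w.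
Proof. by rewrite /dotp -big_split /=; apply: eq_bigr => i _; rewrite mxE mulrDl. Qed.

Lemma dotpZl k u w : dotp (k *: u) w = k * dotp u w.
Proof. by rewrite /dotp big_distrr /=; apply: eq_bigr => i _; rewrite mxE mulrA. Qed.

Lemma dotpNl u w : dotp (- u) w = - dotp u w.
Proof. by rewrite -scaleN1r dotpZl mulN1r. Qed.

Lemma dotpDr u v w : dotp w (u + v) = dotp w u + dotp w v.
Proof. by rewrite dotpC dotpDl !(dotpC w). Qed.

Lemma dotpZr k u w : dotp w (k *: u) = k * dotp w u.
Proof. by rewrite dotpC dotpZl (dotpC w). Qed.

Lemma dotpNr u w : dotp w (- u) = - dotp w u.
Proof. by rewrite dotpC dotpNl (dotpC w). Qed.

Definition dotpE := (dotpDl, dotpDr, dotpNl, dotpNr, dotpZl, dotpZr).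

Lemma dotp_sqrB u v : dotp (u - v) (u - v) = dotp u u - 2 * dotp u v + dotp v v.
Proof. by rewrite !dotpE (dotpC v u); ring. Qed.

Lemma dotp_ge0 u : 0 <= dotp u u.
Proof. by apply: sumr_ge0 => i _; rewrite -expr2 sqr_ge0. Qed.

Lemma dotp_eq0 u : dotp u u = 0 -> u = 0.
Proof.
move=> /eqP; rewrite psumr_eq0 => [|i _]; last by rewrite -expr2 sqr_ge0.
move=> /allP h; apply/rowP => i; rewrite mxE; apply/eqP.
by have := h i (mem_index_enum i); rewrite mulf_eq0 orbb.
Qed.

Lemma dotp0l u : dotp 0 u = 0.
Proof. by rewrite -(scale0r u) dotpZl mul0r. Qed.

Lemma cauchy_schwarz u v : dotp u v ^+ 2 <= dotp u u * dotp v v.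
Proof.
have [u0|un0] := eqVneq (dotp u u) 0.
  by rewrite (dotp_eq0 u0) !dotp0l expr0n mul0r.
have u0 : 0 < dotp u u by rewrite lt_neqAle eq_sym un0 dotp_ge0.
(* The component of [v] orthogonal to [u], scaled by [dotp u u] to avoid a division; its squared
   norm is [dotp u u] times the gap in the inequality. *)
have := dotp_ge0 (dotp u u *: v - dotp u v *: u).
rewrite !dotpE (dotpC v u); set p := dotp u u; set q := dotp u v => h.
rewrite -subr_ge0 -(pmulr_rge0 _ u0) -/p; apply: le_trans h _.
by rewrite le_eqVlt; apply/orP; left; apply/eqP; ring.
Qed.

Lemma euclid_norm_ge0 u : 0 <= euclid_norm u.
Proof. exact: sqrtr_ge0. Qed.

Lemma euclid_norm_sqr u : euclid_norm u ^+ 2 = dotp u u.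
Proof. by rewrite sqr_sqrtr ?dotp_ge0. Qed.

Lemma euclid_norm0 : euclid_norm (0 : 'rV[R]_d) = 0.
Proof. by rewrite /euclid_norm dotp0l sqrtr0. Qed.

Lemma euclid_norm_eq0 u : euclid_norm u = 0 -> u = 0.
Proof. by move=> u0; apply: dotp_eq0; rewrite -euclid_norm_sqr u0 expr0n. Qed.

Lemma euclid_normZ k u : euclid_norm (k *: u) = `|k| * euclid_norm u.
Proof.
by rewrite /euclid_norm !dotpE mulrA -expr2 sqrtrM ?sqr_ge0// sqrtr_sqr.
Qed.

Lemma euclid_normN u : euclid_norm (- u) = euclid_norm u.
Proof. by rewrite -scaleN1r euclid_normZ normrN1 mul1r. Qed.

Lemma euclid_norm_le u k : 0 <= k -> (euclid_norm u <= k) = (dotp u u <= k ^+ 2).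
Proof.
by move=> k0; rewrite -euclid_norm_sqr ler_sqr// nnegrE euclid_norm_ge0.
Qed.

Lemma dotp_le_norm u v : `|dotp u v| <= euclid_norm u * euclid_norm v.
Proof.
rewrite -ler_sqr ?nnegrE ?mulr_ge0 ?euclid_norm_ge0//.
by rewrite exprMn !euclid_norm_sqr real_normK ?num_real// cauchy_schwarz.
Qed.

Lemma euclid_normD u v : euclid_norm (u + v) <= euclid_norm u + euclid_norm v.
Proof.
rewrite euclid_norm_le ?addr_ge0 ?euclid_norm_ge0//.
have := ler_norm (dotp u v); have := dotp_le_norm u v.
rewrite !dotpE (dotpC v u) sqrrD !euclid_norm_sqr; lra.
Qed.

Lemma dotp_unit u : euclid_norm u = 1 -> dotp u u = 1.
Proof. by rewrite -euclid_norm_sqr => ->; rewrite expr1n. Qed.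

Lemma euclid_norm_le_norm u : euclid_norm u <= d%:R * `|u|.
Proof.
rewrite euclid_norm_le ?mulr_ge0//.
apply: (@le_trans _ _ (\sum_(i < d) `|u| ^+ 2)).
  apply: ler_sum => i _; rewrite -expr2 -real_normK ?num_real//.
  rewrite ler_sqr ?nnegrE//; rewrite [leRHS]/Num.norm/= mx_normrE.
  exact: (le_bigmax _ (fun ij => `|u ij.1 ij.2|) (0, i)).
rewrite sumr_const card_ord exprMn -[leLHS]mulr_natl ler_wpM2r ?sqr_ge0//.
by case: d => [|n]; rewrite ?expr0n// expr2 ler_peMr ?ler0n// ler1n.
Qed.

End Euclidean.

(** * The angle as a metric on the unit sphere *)

Section Angle.
Variables (R : realType) (d : nat).
Implicit Types u v w : 'rV[R]_d.

Lemma dotp_unit_itv u v : euclid_norm u = 1 -> euclid_norm v = 1 ->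
  -1 <= dotp u v <= 1.
Proof. by move=> u1 v1; rewrite -ler_norml (le_trans (dotp_le_norm u v))// u1 v1 mul1r. Qed.

Lemma vangle_unit u v : euclid_norm u = 1 -> euclid_norm v = 1 ->
  vangle u v = acos (dotp u v).
Proof. by move=> u1 v1; rewrite /vangle u1 v1 mulr1 divr1. Qed.

Lemma cos_vangle u v : euclid_norm u = 1 -> euclid_norm v = 1 ->
  cos (vangle u v) = dotp u v.
Proof.
by move=> u1 v1; rewrite vangle_unit// acosK// in_itv/= dotp_unit_itv.
Qed.

Lemma vangle_itv u v : euclid_norm u = 1 -> euclid_norm v = 1 ->
  0 <= vangle u v <= pi.
Proof.
by move=> u1 v1; rewrite vangle_unit// acos_ge0 ?acos_lepi// dotp_unit_itv.
Qed.

Lemma vanglexx u : euclid_norm u = 1 -> vangle u u = 0.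
Proof. by move=> u1; rewrite vangle_unit// dotp_unit// acos1. Qed.

Lemma vangleC u v : vangle u v = vangle v u.
Proof. by rewrite /vangle dotpC (mulrC (euclid_norm u)). Qed.

(* Decompose [u] and [w] along [v]: the components orthogonal to [v] have norms
   [sin (vangle u v)] and [sin (vangle v w)]. *)
Lemma vangle_triangle u v w :
  euclid_norm u = 1 -> euclid_norm v = 1 -> euclid_norm w = 1 ->
  vangle u w <= vangle u v + vangle v w.
Proof.
move=> u1 v1 w1.
have /andP[a0 api] := vangle_itv u1 v1.
have /andP[b0 bpi] := vangle_itv v1 w1.
have /andP[c0 cpi] := vangle_itv u1 w1.
have ca := cos_vangle u1 v1; have cb := cos_vangle v1 w1.
have cc := cos_vangle u1 w1.
set a := vangle u v in a0 api ca *; set b := vangle v w in b0 bpi cb *.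
set c := vangle u w in c0 cpi cc *.
have sa : 0 <= sin a by apply: sin_ge0_pi; rewrite a0.
have sb : 0 <= sin b by apply: sin_ge0_pi; rewrite b0.
have csa := cos2Dsin2 a; have csb := cos2Dsin2 b.
have [abpi|] := leP (a + b) pi; last by move=> h; rewrite ltW// (le_lt_trans cpi).
suff : cos (a + b) <= cos c.
  by rewrite leNgt ltr_cos -?leNgt// in_itv/=; apply/andP; lra.
have := cauchy_schwarz (u - cos a *: v) (w - cos b *: v).
rewrite !dotpE (dotpC v u) (dotpC w v) !dotp_unit// -ca -cb -cc => h.
rewrite cosD.
have {}h : (cos c - cos a * cos b) ^+ 2 <= (sin a * sin b) ^+ 2.
  rewrite exprMn (_ : sin a ^+ 2 = 1 - cos a ^+ 2); last by lra.
  rewrite (_ : sin b ^+ 2 = 1 - cos b ^+ 2); last by lra.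
  apply: le_trans (le_trans h _); rewrite le_eqVlt; apply/orP; left; apply/eqP; ring.
have := mulr_ge0 sa sb; set p := sin a * sin b in h * => p0.
have [hc|hc] := leP (- p) (cos c - cos a * cos b); first by lra.
nra.
Qed.

Lemma euclid_dist_sqr_unit u v : euclid_norm u = 1 -> euclid_norm v = 1 ->
  euclid_norm (v - u) ^+ 2 = 2 - 2 * cos (vangle u v).
Proof.
move=> u1 v1; rewrite cos_vangle// euclid_norm_sqr !dotpE !dotp_unit// (dotpC v u).
by ring.
Qed.

(** The squared chord is at least [(1 - h^2/4) h^2] for the angle [h], and [(1 - e)^2 <= 1 - h^2/4]
    once [h <= e <= 1]. The loss is a factor rather than an additive error, so it survives summation
    over subdivisions. *)
Lemma chord_ge u v (e : R) : euclid_norm u = 1 -> euclid_norm v = 1 ->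
  0 < e <= 1 -> vangle u v <= e ->
  (1 - e) * vangle u v <= euclid_norm (v - u).
Proof.
move=> u1 v1 /andP[e0 e1] he; have /andP[h0 hpi] := vangle_itv u1 v1.
rewrite -ler_sqr ?nnegrE ?euclid_norm_ge0 ?mulr_ge0//; last by lra.
rewrite euclid_dist_sqr_unit//; set h := vangle u v in he h0 hpi *.
have h0pi : 0 <= h <= pi by rewrite h0.
apply: le_trans (cos_le_quartic h0pi).
have -> : h ^+ 2 - h ^+ 4 / 4 = (1 - h ^+ 2 / 4) * h ^+ 2 by field.
rewrite exprMn ler_wpM2r ?sqr_ge0//; nra.
Qed.

End Angle.

(** * Curve length, and the lower bound of a motion's length by its angle *)

Section CurveLength.
Variables (R : realType) (d : nat).
Implicit Types (c A B : R -> 'rV[R]_d) (a b m : R).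

Lemma polyline_length_nil c a : polyline_length c a [::] = 0.
Proof. by rewrite /polyline_length big_nil. Qed.

Lemma polyline_length_cons c a x s :
  polyline_length c a (x :: s) = euclid_dist (c a) (c x) + polyline_length c x s.
Proof.
rewrite /polyline_length big_nat_recl//=; congr (_ + _).
apply: eq_big_nat => i /andP[_ si].
rewrite (set_nth_default x)//=; last by rewrite ltnW.
by congr (euclid_dist _ (c _)); exact: set_nth_default.
Qed.

Lemma polyline_length_cat c a s t :
  polyline_length c a (s ++ t) =
  polyline_length c a s + polyline_length c (last a s) t.
Proof.
elim: s a => [|x s ih] a /=; first by rewrite polyline_length_nil add0r.
by rewrite !polyline_length_cons ih addrA.
Qed.

Lemma curve_length_ge c a b s : itv_partition a b s ->
  ((polyline_length c a s)%:E <= curve_length a b c)%E.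
Proof. by move=> ps; apply: ereal_sup_ubound; exists s. Qed.

Lemma curve_length_ge_dist c a b : a <= b ->
  ((euclid_dist (c a) (c b))%:E <= curve_length a b c)%E.
Proof.
rewrite le_eqVlt => /predU1P[<-|ab].
  have ps : itv_partition a a [::] by split => /=.
  have := curve_length_ge c ps.
  by rewrite polyline_length_nil /euclid_dist subrr euclid_norm0.
have := curve_length_ge c (itv_partition1 ab).
by rewrite polyline_length_cons polyline_length_nil addr0.
Qed.

Lemma curve_length_ge0 c a b : a <= b -> (0 <= curve_length a b c)%E.
Proof.
move=> ab; apply: le_trans (curve_length_ge_dist c ab).
by rewrite lee_fin euclid_norm_ge0.
Qed.

(** Partitions of the two pieces concatenate to one of the whole. When the whole length is a real
    [r], the two suprema are taken one after the other: over the left partition with the right one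
    fixed, then over the right. *)
Lemma curve_length_superadditive c a m b : a <= m -> m <= b ->
  (curve_length a m c + curve_length m b c <= curve_length a b c)%E.
Proof.
move=> am mb.
have h0 := curve_length_ge0 c (le_trans am mb).
have h1 := curve_length_ge0 c am.
have cat s t : itv_partition a m s -> itv_partition m b t ->
    ((polyline_length c a s + polyline_length c m t)%:E <= curve_length a b c)%E.
  move=> ps pt; have := curve_length_ge c (itv_partition_cat ps pt).
  by case: ps => _ /eqP lm; rewrite polyline_length_cat lm.
case: (curve_length a b c) h0 cat => [r _ cat| _ _|//]; last by rewrite leey.
have le1 t : itv_partition m b t ->
    (curve_length a m c <= (r - polyline_length c m t)%:E)%E.
  move=> pt; apply: ge_ereal_sup => _ [s ps <-].
  by have := cat _ _ ps pt; rewrite !lee_fin; lra.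
have [t0 pt0] : exists t, itv_partition m b t.
  move: mb; rewrite le_eqVlt => /predU1P[<-|mb']; first by exists [::]; split => /=.
  by exists [:: b]; exact: itv_partition1.
case: (curve_length a m c) h1 le1 => [r1 _ le1|_ /(_ _ pt0)//|//].
rewrite -leeBrDl//; apply: ge_ereal_sup => _ [t pt <-].
by have := le1 _ pt; rewrite -EFinB !lee_fin; lra.
Qed.

(** Along a partition the increments of [g] telescope. *)
Lemma curve_length_le c (g : R -> R) a b : a <= b ->
  (forall x y, a <= x -> x <= y -> y <= b ->
    euclid_dist (c x) (c y) <= g y - g x) ->
  (curve_length a b c <= (g b - g a)%:E)%E.
Proof.
move=> ab hg; apply: ge_ereal_sup => _ [s ps <-]; rewrite lee_fin.
elim: s a {ab} hg ps => [|x s ih] a hg ps.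
  by rewrite (itv_partition_nil ps) polyline_length_nil subrr.
have ax : a <= x by case: ps => /= /andP[/ltW].
have ps' := itv_partition_cons ps.
have xb := itv_partition_le ps'.
rewrite polyline_length_cons -(subrK (g x) (g b)) -addrA addrC lerD//.
  exact: hg.
by apply: ih => // y z xy; apply: hg; exact: le_trans xy.
Qed.

Lemma pair_length_ge A B a b : a <= b ->
  ((euclid_norm (A b - A a) + euclid_norm (B b - B a))%:E <=
   curve_length a b A + curve_length a b B)%E.
Proof. by move=> ab; rewrite EFinD leeD// curve_length_ge_dist. Qed.

Lemma pair_length_superadditive A B a m b : a <= m -> m <= b ->
  ((curve_length a m A + curve_length a m B) +
   (curve_length m b A + curve_length m b B) <=
   curve_length a b A + curve_length a b B)%E.
Proof. by move=> am mb; rewrite addeACA leeD// curve_length_superadditive. Qed.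

Definition angle_continuous (D : R -> 'rV[R]_d) := forall x e,
  0 <= x <= 1 -> 0 < e -> exists2 k, 0 < k & forall t, 0 <= t <= 1 ->
    x - k < t < x + k -> vangle (D x) (D t) < e.

(** Locally, the displacements of [A] and [B] together dominate the chord of [B - A], hence [1 - e]
    times the angle it turns through. By [cousin] this adds up over the interval: angles are
    subadditive and lengths superadditive. Then [e] tends to [0]. *)
Lemma vangle_le_pair_length A B a b : 0 <= a -> a <= b -> b <= 1 ->
  (forall t, 0 <= t <= 1 -> euclid_norm (B t - A t) = 1) ->
  angle_continuous (fun t => B t - A t) ->
  ((vangle (B a - A a) (B b - A b))%:E <=
   curve_length a b A + curve_length a b B)%E.
Proof.
move=> a0 ab b1 unitD contD; pose D t := B t - A t.
have H e : 0 < e <= 1 -> (((1 - e) * vangle (D a) (D b))%:E <=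
    curve_length a b A + curve_length a b B)%E.
  move=> /andP[e0 e1].
  pose P (s t : R) := (((1 - e) * vangle (D s) (D t))%:E <=
    curve_length s t A + curve_length s t B)%E.
  suff : P a b by [].
  apply: (cousin (P := P) ab); rewrite /P {P}.
    move=> s m t as_ sm mt tb h1 h2.
    apply: le_trans (pair_length_superadditive _ _ sm mt).
    apply: le_trans (leeD h1 h2); rewrite -EFinD lee_fin -mulrDr.
    by rewrite ler_wpM2l ?subr_ge0// vangle_triangle// unitD//; lra.
  move=> x /andP[ax xb].
  have [||k k0 hk] := contD x (e / 2); [lra..|].
  exists k => // s t as_ sx xt tb ks kt.
  apply: le_trans (pair_length_ge _ _ _); last by lra.
  rewrite lee_fin.
  have us : euclid_norm (D s) = 1 by apply: unitD; lra.
  have ut : euclid_norm (D t) = 1 by apply: unitD; lra.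
  have ux : euclid_norm (D x) = 1 by apply: unitD; lra.
  apply: (@le_trans _ _ (euclid_norm (D t - D s))).
    apply: chord_ge; rewrite ?e0//.
    apply: le_trans (vangle_triangle us ux ut) _; rewrite (vangleC (D s)).
    have h1 : vangle (D x) (D s) < e / 2 by apply: hk; lra.
    have h2 : vangle (D x) (D t) < e / 2 by apply: hk; lra.
    lra.
  rewrite addrC -[euclid_norm (A t - A s)]euclid_normN.
  apply: le_trans (euclid_normD _ _).
  by rewrite /D !opprB addrACA [in leRHS]addrACA (addrC (- A t)).
have : (0 <= curve_length a b A + curve_length a b B)%E.
  by rewrite adde_ge0// curve_length_ge0.
case: (curve_length a b A + curve_length a b B)%E H => [r H _|_ _|//]; last by rewrite leey.
rewrite lee_fin; apply/ler_addgt0Pr => e e0.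
have /andP[v0 _] : 0 <= vangle (D a) (D b) <= pi by apply: vangle_itv; apply: unitD; lra.
set v := vangle (D a) (D b) in H v0 *.
(* With this value as the loss factor, the total loss [e / (1 + v + e) * v] is at most [e]. *)
have f0 : 0 < e / (1 + v + e) <= 1.
  by rewrite divr_gt0 ?ler_pdivrMr ?mul1r//=; lra.
have := H _ f0; rewrite lee_fin mulrBl mul1r -/v => h.
have : e / (1 + v + e) * v <= e.
  by rewrite -mulrAC ler_pdivrMr; nra.
lra.
Qed.

End CurveLength.

(** * Motions whose length equals the angle *)

Section TightMotion.
Variables (R : realType) (d : nat).
Implicit Types (A B D : R -> 'rV[R]_d) (phi : R -> R) (th : R) (w : 'rV[R]_d).

(* A motion of minimal length, seen through the angle [phi] swept so far: both
   the spherical length of the direction [B - A] and the length of the motion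
   are measured by [phi]. *)
Record tight_motion A B phi th : Prop := TightMotion {
  tight_speed : forall s t, 0 <= s -> s <= t -> t <= 1 ->
    euclid_norm (A t - A s) + euclid_norm (B t - B s) <= phi t - phi s;
  tight_dotp : forall s t, 0 <= s -> s <= t -> t <= 1 ->
    dotp (B s - A s) (B t - A t) = cos (phi t - phi s);
  tight_start : phi 0 = 0;
  tight_end : phi 1 = th;
  tight_le_pi : th <= pi;
  tight_cont : forall x e, 0 <= x <= 1 -> 0 < e -> exists2 k, 0 < k &
    forall s t, 0 <= s -> s <= x -> x <= t -> t <= 1 ->
      x - k < s -> t < x + k -> phi t - phi s < e
}.

(** Exchanging the endpoints negates the direction, which leaves inner products of directions
    unchanged. Facts about [B] thereby transfer to [A]. *)
Lemma tight_motion_swap A B phi th :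
  tight_motion A B phi th -> tight_motion B A phi th.
Proof.
case=> h1 h2 h3 h4 h5 h6; split => //.
  by move=> s t s0 st t1; rewrite addrC h1.
move=> s t s0 st t1; rewrite -h2// -(opprB (B s)) -(opprB (B t)).
by rewrite dotpNl dotpNr opprK.
Qed.

Lemma continuous_euclid (f : R -> 'rV[R]_d) : {within `[0, 1], continuous f} ->
  forall x e, 0 <= x <= 1 -> 0 < e -> exists2 k, 0 < k & forall t, 0 <= t <= 1 ->
    x - k < t < x + k -> euclid_norm (f t - f x) < e.
Proof.
move=> /subspace_continuousP cf x e x01 e0.
have d0 : 0 < e / (d%:R + 1) by rewrite divr_gt0// ltr_wpDl.
have := cf x; rewrite /= in_itv/= => /(_ x01)/cvgrPdist_lt/(_ _ d0).
rewrite near_withinE => -[k /= k0 hk]; exists k => // t t01 xt.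
have := hk t; rewrite /ball_/= in_itv/= => /(_ _ t01) h.
rewrite -opprB euclid_normN; apply: le_lt_trans (euclid_norm_le_norm _) _.
have {}h : `|f x - f t| < e / (d%:R + 1) by apply: h; rewrite ltr_norml; lra.
have d1 : (0 : R) <= d%:R by [].
move: h; rewrite ltr_pdivlMr; last by lra.
by have := normr_ge0 (f x - f t); nra.
Qed.

Lemma angle_continuous_motion A B :
  {within `[0, 1], continuous A} -> {within `[0, 1], continuous B} ->
  (forall t, 0 <= t <= 1 -> euclid_norm (B t - A t) = 1) ->
  angle_continuous (fun t => B t - A t).
Proof.
move=> cA cB unitD x e0 x01 e0_gt0.
(* Capping at [pi] keeps the angles in the range where [cos] is strictly decreasing. *)
pose e := Num.min e0 pi.
have e_gt0 : 0 < e by rewrite lt_min e0_gt0 pi_gt0.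
have e_pi : e <= pi by rewrite ge_min lexx orbT.
have e_e0 : e <= e0 by rewrite ge_min lexx.
have ce : cos e < 1.
  by rewrite -cos0 ltr_cos// in_itv/= ?lexx ?pi_ge0// (ltW e_gt0).
(* [Num.sqrt (2 - 2 * cos e)] is the chord subtending the angle [e]; each endpoint is allowed half
   of it. *)
have h0 : 0 < Num.sqrt (2 - 2 * cos e) / 2 by rewrite divr_gt0// sqrtr_gt0 subr_gt0 -[ltRHS]mulr1 ltr_pM2l.
have [k1 k10 hk1] := continuous_euclid cA x01 h0.
have [k2 k20 hk2] := continuous_euclid cB x01 h0.
exists (Num.min k1 k2); first by rewrite lt_min k10.
move=> t t01 /andP[xt tx].
have m1 : Num.min k1 k2 <= k1 by rewrite ge_min lexx.
have m2 : Num.min k1 k2 <= k2 by rewrite ge_min lexx orbT.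
have {}hk1 : euclid_norm (A t - A x) < Num.sqrt (2 - 2 * cos e) / 2.
  by apply: hk1 => //; apply/andP; lra.
have {}hk2 : euclid_norm (B t - B x) < Num.sqrt (2 - 2 * cos e) / 2.
  by apply: hk2 => //; apply/andP; lra.
have ux := unitD _ x01; have ut := unitD _ t01.
have /andP[v0 vpi] := vangle_itv ux ut.
apply: lt_le_trans e_e0.
rewrite -ltr_cos ?in_itv/= ?v0// ?e_pi ?(ltW e_gt0)//.
have := euclid_dist_sqr_unit ux ut => /= dE.
have : euclid_norm (B t - A t - (B x - A x)) < Num.sqrt (2 - 2 * cos e).
  rewrite opprB addrACA (addrC (- A t)) addrACA addrC.
  apply: le_lt_trans (euclid_normD _ _) _.
  by rewrite -(opprB (A t)) euclid_normN; lra.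
rewrite -ltr_sqr ?nnegrE ?euclid_norm_ge0// ?sqrtr_ge0// dE sqr_sqrtr; lra.
Qed.

(** The length of every piece is at least its angle, while the lengths of the pieces sum to at most
    the total angle [th]. Hence angles from the start are additive, and no piece has room for
    displacements exceeding its own angle. *)
Lemma tight_motion_of_length A B th :
  {within `[0, 1], continuous A} -> {within `[0, 1], continuous B} ->
  (forall t, 0 <= t <= 1 -> euclid_norm (B t - A t) = 1) ->
  th = vangle (B 0 - A 0) (B 1 - A 1) ->
  motion_length A B = th%:E ->
  tight_motion A B (fun t => vangle (B 0 - A 0) (B t - A t)) th.
Proof.
move=> cA cB unitD thE lenE.
have cD := angle_continuous_motion cA cB unitD.
pose v s t := vangle (B s - A s) (B t - A t).
have thE' : th = v 0 1 by [].
(* Any lower bounds for the three pieces cut at [s] and [t] sum to at most [th]; the claims below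
   come from different choices of these bounds. *)
have split3 s t p q r : 0 <= s -> s <= t -> t <= 1 ->
    (p%:E <= curve_length 0 s A + curve_length 0 s B)%E ->
    (q%:E <= curve_length s t A + curve_length s t B)%E ->
    (r%:E <= curve_length t 1 A + curve_length t 1 B)%E -> p + q + r <= th.
  move=> s0 st t1 hp hq hr.
  rewrite -lee_fin -lenE /motion_length !EFinD.
  apply: le_trans (pair_length_superadditive A B (le_trans s0 st) t1).
  apply: leeD hr; apply: le_trans (pair_length_superadditive A B s0 st).
  exact: leeD.
have vle s t : 0 <= s -> s <= t -> t <= 1 ->
    ((v s t)%:E <= curve_length s t A + curve_length s t B)%E.
  by move=> s0 st t1; apply: vangle_le_pair_length.
have triangle s m t : 0 <= s <= 1 -> 0 <= m <= 1 -> 0 <= t <= 1 ->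
    v s t <= v s m + v m t.
  by move=> s01 m01 t01; apply: vangle_triangle; apply: unitD.
have v1 t : 0 <= t -> t <= 1 -> v 0 t + v t 1 = th.
  move=> t0 t1; apply/eqP; rewrite eq_le; apply/andP; split.
    have := @split3 0 t 0 (v 0 t) (v t 1) (lexx _) t0 t1.
    rewrite add0r; apply; [|exact: vle..].
    by rewrite adde_ge0// curve_length_ge0.
  by rewrite thE'; apply: triangle; lra.
have vst s t : 0 <= s -> s <= t -> t <= 1 -> v s t = v 0 t - v 0 s.
  move=> s0 st t1; have h1 := v1 t (le_trans s0 st) t1.
  have := @split3 s t (v 0 s) (v s t) (v t 1) s0 st t1.
  have h2 := vle 0 s (lexx _) s0 (le_trans st t1).
  move=> /(_ h2 (vle _ _ s0 st t1) (vle _ _ (le_trans s0 st) t1 (lexx _))).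
  have : v 0 t <= v 0 s + v s t by apply: triangle; lra.
  lra.
split => //.
- move=> s t s0 st t1.
  have h1 := v1 t (le_trans s0 st) t1.
  have := @split3 s t (v 0 s) _ (v t 1) s0 st t1.
  have h2 := vle 0 s (lexx _) s0 (le_trans st t1).
  move=> /(_ _ h2 (pair_length_ge _ _ st) (vle _ _ (le_trans s0 st) t1 (lexx _))).
  rewrite -/(v 0 s) -/(v 0 t); lra.
- move=> s t s0 st t1; rewrite -/(v 0 s) -/(v 0 t) -vst// cos_vangle//; apply: unitD; lra.
- by rewrite vanglexx// unitD// lexx ler01.
- have /andP[] : 0 <= v 0 1 <= pi by apply: vangle_itv; apply: unitD; lra.
  by rewrite -thE'.
- move=> x e x01 e0; have [|k k0 hk] := cD x (e / 2) x01; first by lra.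
  exists k => // s t s0 sx xt t1 ks kt.
  rewrite -/(v 0 s) -/(v 0 t) -vst//; last exact: le_trans sx xt.
  have : v s t <= v s x + v x t by apply: triangle; lra.
  have : v x s < e / 2 by apply: hk; lra.
  have : v x t < e / 2 by apply: hk; lra.
  rewrite /v (vangleC (B s - A s) (B x - A x)); lra.
Qed.

(* The hypotheses confine [b] to a thin ellipse with foci [0] and [dl], so [b] is
   within [h ^+ 2 / 2] of the multiple [(|b| / h) dl] of [dl]. *)
Lemma thin_ellipse (b dl w : 'rV[R]_d) (h : R) : 0 <= h ->
  euclid_norm b + euclid_norm (b - dl) <= h ->
  h ^+ 2 - h ^+ 4 / 4 <= dotp dl dl -> 0 <= dotp w dl ->
  - (euclid_norm w * (h ^+ 2 / 2)) <= dotp w b.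
Proof.
move=> h0 sum_le dl_ge wdl.
have b0 := euclid_norm_ge0 b; have bd0 := euclid_norm_ge0 (b - dl).
move: h0; rewrite le_eqVlt => /predU1P[h0|h0].
  have /euclid_norm_eq0 -> : euclid_norm b = 0 by lra.
  by rewrite dotpC dotp0l -h0 expr0n/= mul0r mulr0 oppr0.
have dl_le : dotp dl dl <= h ^+ 2.
  rewrite -euclid_norm_le ?(ltW h0)//; apply: le_trans sum_le.
  rewrite -[X in euclid_norm X <= _](subrK b) addrC.
  by apply: le_trans (euclid_normD _ _) _; rewrite -opprB euclid_normN.
have bE := euclid_norm_sqr b; have bdE := euclid_norm_sqr (b - dl).
set n := euclid_norm b in sum_le b0 bE *; set m := euclid_norm (b - dl) in sum_le bd0 bdE *.
have h1 : m ^+ 2 <= (h - n) ^+ 2 by rewrite ler_sqr ?nnegrE//; lra.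
(* Squaring [m <= h - n] bounds the inner product of [b] and [dl] from below; after expansion the
   left side is at most [h^5 n / 4], and [n <= h]. *)
have dev : dotp (h *: b - n *: dl) (h *: b - n *: dl) <= (h ^+ 3 / 2) ^+ 2.
  move: bdE; rewrite !dotpE (dotpC dl b) -bE => bdE.
  set p := dotp b dl in bdE *; set q := dotp dl dl in bdE dl_ge dl_le *.
  have hp : 2 * h * n - h ^+ 4 / 4 <= 2 * p by nra.
  have hn : 0 <= h * n by rewrite mulr_ge0// ltW.
  have e1 : n ^+ 2 * q <= n ^+ 2 * h ^+ 2 by rewrite ler_wpM2l ?sqr_ge0.
  have e2 : h * n * (2 * h * n - h ^+ 4 / 4) <= h * n * (2 * p) by rewrite ler_wpM2l.
  have e3 : h ^+ 5 * n <= h ^+ 5 * h by rewrite ler_wpM2l ?exprn_ge0 ?(ltW h0)//; lra.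
  nra.
rewrite -euclid_norm_le in dev; last by rewrite divr_ge0// exprn_ge0// ltW.
rewrite -(ler_pM2l h0) -dotpZr -[h *: b](subrK (n *: dl)) dotpDr.
have := dotp_le_norm w (h *: b - n *: dl); rewrite ler_norml => /andP[h2 _].
have w0 := euclid_norm_ge0 w.
have h3 : euclid_norm w * euclid_norm (h *: b - n *: dl) <= euclid_norm w * (h ^+ 3 / 2).
  exact: ler_wpM2l.
have h4 : 0 <= dotp w (n *: dl) by rewrite dotpZr mulr_ge0.
have -> : h * - (euclid_norm w * (h ^+ 2 / 2)) = - (euclid_norm w * (h ^+ 3 / 2)) by ring.
lra.
Qed.

Section Tight.
Variables (A B : R -> 'rV[R]_d) (phi : R -> R) (th : R).
Hypothesis tight : tight_motion A B phi th.
Let D t := B t - A t.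

Lemma tight_angle_le s t : 0 <= s -> s <= t -> t <= 1 -> phi s <= phi t.
Proof.
move=> s0 st t1; rewrite -subr_ge0; apply: le_trans (tight_speed tight s0 st t1).
by rewrite addr_ge0// euclid_norm_ge0.
Qed.

Lemma tight_angle_itv t : 0 <= t -> t <= 1 -> 0 <= phi t <= th.
Proof.
by move=> t0 t1; rewrite -(tight_start tight) -(tight_end tight) !tight_angle_le.
Qed.

Lemma tight_dir_sqr t : 0 <= t -> t <= 1 -> dotp (D t) (D t) = 1.
Proof. by move=> t0 t1; rewrite (tight_dotp tight)// subrr cos0. Qed.

(** [thin_ellipse], with [dl] the increment of [D], bounds the change of [dotp w B] on a short piece
    below by minus a multiple of the squared angle. This second-order error is at most [e] times the
    angle, so the pieces add up to [- e] times the whole angle, and [e] is arbitrary. *)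
Lemma tight_forward s t w : 0 <= s -> s <= t -> t <= 1 ->
  (forall x y, s <= x -> x <= y -> y <= t -> dotp w (D x) <= dotp w (D y)) ->
  0 <= dotp w (B t - B s).
Proof.
move=> s0 st t1 mono.
have H e : 0 < e -> - (e * (phi t - phi s)) <= dotp w (B t - B s).
  move=> e0; pose P (x y : R) := - (e * (phi y - phi x)) <= dotp w (B y - B x).
  suff : P s t by [].
  apply: (cousin (P := P) st); rewrite /P {P}.
    move=> x m y _ _ _ _ h1 h2.
    rewrite -(subrKA (B m)) -(subrKA (phi m) (phi y)) dotpDr mulrDr; lra.
  move=> x /andP[sx xt].
  have w0 := euclid_norm_ge0 w.
  (* If the angle [h] is below this threshold, then [|w| h^2 / 2 <= e h]; the [+ 1] covers
     [w = 0]. *)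
  have e'0 : 0 < 2 * e / (euclid_norm w + 1) by rewrite divr_gt0; lra.
  have x01 : 0 <= x <= 1 by apply/andP; lra.
  have [k k0 hk] := tight_cont tight x01 e'0.
  exists k => // y z sy yx xz zt yk zk.
  have y0 : 0 <= y by lra.
  have yz : y <= z by lra.
  have z1 : z <= 1 by lra.
  have hlt : phi z - phi y < 2 * e / (euclid_norm w + 1) by apply: hk => //; lra.
  have sp := tight_speed tight y0 yz z1.
  have dE := tight_dotp tight y0 yz z1.
  have h0 : 0 <= phi z - phi y by rewrite subr_ge0 tight_angle_le.
  have hpi : phi z - phi y <= pi.
    have /andP[_ h1] := tight_angle_itv (le_trans y0 yz) z1.
    have /andP[h2 _] := tight_angle_itv y0 (le_trans yz z1).
    have := tight_le_pi tight; lra.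
  set h := phi z - phi y in hlt sp dE h0 hpi *.
  have := @thin_ellipse (B z - B y) (D z - D y) w h h0.
  have -> : B z - B y - (D z - D y) = A z - A y.
    by rewrite /D; apply/rowP => i; rewrite !mxE; ring.
  rewrite addrC => /(_ sp).
  have -> : dotp (D z - D y) (D z - D y) = 2 - 2 * cos h.
    rewrite -dE -/(D y) -/(D z) dotp_sqrB (dotpC (D z) (D y)).
    by rewrite !tight_dir_sqr; [ring|lra..].
  have hi : 0 <= h <= pi by rewrite h0.
  move=> /(_ (cos_le_quartic hi)).
  rewrite dotpDr dotpNr subr_ge0 => /(_ (mono _ _ sy yz zt)) => h1.
  apply: le_trans h1; rewrite lerN2.
  move: hlt; rewrite ltr_pdivlMr; last by lra.
  nra.
apply/ler_addgt0Pr => e e0.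
have c0 : 0 <= phi t - phi s by rewrite subr_ge0 tight_angle_le.
set c := phi t - phi s in H c0 *.
have e'0 : 0 < e / (c + 1) by rewrite divr_gt0; lra.
have := H _ e'0.
have : e / (c + 1) * c <= e by rewrite -mulrAC ler_pdivrMr; nra.
lra.
Qed.

End Tight.

(** In the swapped motion the direction is negated, so [- w] satisfies the monotonicity hypothesis
    of [tight_forward]. *)
Lemma tight_backward A B phi th s t w : tight_motion A B phi th ->
  0 <= s -> s <= t -> t <= 1 ->
  (forall x y, s <= x -> x <= y -> y <= t ->
    dotp w (B x - A x) <= dotp w (B y - A y)) ->
  dotp w (A t - A s) <= 0.
Proof.
move=> tight s0 st t1 mono; rewrite -oppr_ge0 -dotpNl.
apply: (tight_forward (tight_motion_swap tight)) => // x y sx xy yt.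
by rewrite -!(opprB (B _)) !dotpNl !dotpNr !opprK mono.
Qed.

(** Intermediate values for the monotone [phi]: if the value [v] were never taken, lying below [v]
    would propagate from [0] to [1]. *)
Lemma tight_angle_onto A B phi th v : tight_motion A B phi th ->
  0 <= v -> v <= th -> exists2 s, 0 <= s <= 1 & phi s = v.
Proof.
move=> tight v0 vth; apply: contrapT => /forall2NP no.
have neq s : 0 <= s <= 1 -> phi s != v by move=> s01; have [|/eqP] := no s.
pose P s t := phi s < v -> phi t < v.
suff : P 0 1.
  have := neq 0; have := neq 1.
  rewrite /P (tight_start tight) (tight_end tight) !lexx ler01 => h1 h0.
  have := h1 isT; have := h0 isT => /eqP h0' /eqP h1' h.
  have : th < v by apply: h; rewrite lt_neqAle v0 andbT; apply/eqP.
  lra.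
apply: cousin => //.
  by move=> s m t _ _ _ _ h1 h2 /h1.
move=> x x01.
(* Near [x] the oscillation of [phi] is smaller than its distance to [v], so [phi] cannot jump
   across [v]. *)
have e0 : 0 < `|v - phi x| by rewrite normr_gt0 subr_eq0 eq_sym neq.
have [k k0 hk] := tight_cont tight x01 e0.
exists k => // s t s0 sx xt t1 sk tk; rewrite /P => sv.
have h := hk s t s0 sx xt t1 sk tk.
have hs := tight_angle_le tight s0 sx (le_trans xt t1).
have ht := tight_angle_le tight (le_trans s0 sx) xt t1.
have [xv|vx] := ltP (phi x) v.
  by move: h; rewrite gtr0_norm ?subr_gt0//; lra.
move: h; rewrite ler0_norm ?subr_le0//; lra.
Qed.

(** Gram-Schmidt on two directions gives the frame. Every [D t] has components [cos (phi t)] and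
    [sin (phi t)] in it; their squares already sum to the squared norm of [D t], so nothing is left
    outside the plane. *)
Lemma tight_planar A B phi th : tight_motion A B phi th -> 0 < th ->
  exists e1 e2, [/\ dotp e1 e1 = 1, dotp e2 e2 = 1, dotp e1 e2 = 0 &
    forall t, 0 <= t <= 1 ->
      B t - A t = cos (phi t) *: e1 + sin (phi t) *: e2].
Proof.
move=> tight th0.
(* The second direction is taken at half the angle because [D 0] and [D 1] are dependent when
   [th = pi], whereas [sin (th / 2)] is positive. *)
have [m /andP[m0 m1] phim] : exists2 m, 0 <= m <= 1 & phi m = th / 2.
  by apply: (tight_angle_onto tight); lra.
have thpi := tight_le_pi tight.
have s0 : sin (th / 2) != 0 by rewrite gt_eqF// sin_gt0_pi//; lra.
have csm := cos2Dsin2 (th / 2).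
pose D t := B t - A t.
have dot s t : 0 <= s <= 1 -> 0 <= t <= 1 -> dotp (D s) (D t) = cos (phi t - phi s).
  move=> /andP[s0' s1] /andP[t0 t1]; have [st|ts] := leP s t.
    exact: (tight_dotp tight).
  by rewrite dotpC -opprB cosN; apply: (tight_dotp tight) => //; exact: ltW.
have Z01 : (0 : R) <= (0 : R) <= 1 by lra.
have M01 : 0 <= m <= 1 by lra.
pose e1 := D 0; pose e2 := (sin (th / 2))^-1 *: (D m - cos (th / 2) *: e1).
have phi0 := tight_start tight.
have e11 : dotp e1 e1 = 1 by rewrite dot// subrr cos0.
have e1m : dotp e1 (D m) = cos (th / 2) by rewrite dot// phi0 subr0 phim.
have mm : dotp (D m) (D m) = 1 by rewrite dot// subrr cos0.
have e12 : dotp e1 e2 = 0.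
  by rewrite dotpZr dotpDr dotpNr dotpZr e11 e1m mulr1 subrr mulr0.
have e22 : dotp e2 e2 = 1.
  rewrite dotpZl dotpZr dotp_sqrB dotpZl !dotpZr mm e11 (dotpC _ e1) e1m.
  rewrite (_ : _ + _ = sin (th / 2) ^+ 2); last by lra.
  by field.
exists e1, e2; split => // t t01.
apply/eqP; rewrite -subr_eq0; apply/eqP; apply: dotp_eq0.
have te1 : dotp (D t) e1 = cos (phi t) by rewrite dotpC dot// phi0 subr0.
have te2 : dotp (D t) e2 = sin (phi t).
  rewrite dotpZr dotpDr dotpNr dotpZr te1 dotpC dot// phim cosB.
  by field.
move: (dot t t t01 t01) te1 te2; rewrite -/(D t) subrr cos0.
move: (D t) => v vv v1 v2.
move: e11 e12 e22; move: (e1) (e2) v1 v2 => f1 f2 v1 v2 f11 f12 f22.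
rewrite dotp_sqrB !dotpE v1 v2 vv (dotpC f2 f1) f11 f12 f22.
have := cos2Dsin2 (phi t); lra.
Qed.

(** For [w] normal to the plane of directions, [dotp w D] vanishes, so [tight_forward] applies to
    both [w] and [- w]. The normal part [v] of the displacement is then orthogonal to the
    displacement, hence zero. *)
Lemma tight_displacement_planar A B phi th e1 e2 : tight_motion A B phi th ->
  dotp e1 e1 = 1 -> dotp e2 e2 = 1 -> dotp e1 e2 = 0 ->
  (forall t, 0 <= t <= 1 -> B t - A t = cos (phi t) *: e1 + sin (phi t) *: e2) ->
  exists x y, B 1 - B 0 = x *: e1 + y *: e2.
Proof.
move=> tight e11 e22 e12 DE.
have perp w : dotp w e1 = 0 -> dotp w e2 = 0 -> 0 <= dotp w (B 1 - B 0).
  move=> we1 we2; apply: (tight_forward tight) => // s t s0 st t1.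
  by rewrite !DE ?dotpDr ?dotpZr ?we1 ?we2 ?mulr0//; apply/andP; lra.
move: (B 1 - B 0) perp => X perp; exists (dotp X e1), (dotp X e2).
pose v := X - (dotp X e1 *: e1 + dotp X e2 *: e2).
have v1 : dotp v e1 = 0.
  by rewrite /v !dotpE e11 (dotpC e2) e12; ring.
have v2 : dotp v e2 = 0.
  by rewrite /v !dotpE e22 e12; ring.
have vX : dotp v X = 0.
  apply/eqP; rewrite eq_le perp// andbT -oppr_ge0 -dotpNl.
  by apply: perp; rewrite dotpNl ?v1 ?v2 oppr0.
apply/eqP; rewrite -subr_eq0; apply/eqP; apply: dotp_eq0; rewrite -/v.
by rewrite {2}/v; clearbody v; rewrite !dotpE vX v1 v2; ring.
Qed.

End TightMotion.

(** * Orthonormal frames of two-dimensional subspaces *)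

Section Planes.
Variables (R : realType) (d : nat).
Implicit Types u v e f : 'rV[R]_d.

Lemma mulmx_trE u v : u *m v^T = (dotp u v)%:M.
Proof.
by apply/matrixP => i j; rewrite !ord1 !mxE; apply: eq_bigr => k _; rewrite mxE.
Qed.

Definition orthonormal2 e f := [/\ dotp e e = 1, dotp f f = 1 & dotp e f = 0].

Lemma orthonormal2_rank e f : orthonormal2 e f -> \rank (col_mx e f) = 2%N.
Proof.
case=> ee ff ef; apply/eqP; rewrite -[_ == _]/(row_free (col_mx e f)).
apply/row_freeP; exists (row_mx e^T f^T).
rewrite mul_col_row !mulmx_trE ee ff ef (dotpC f) ef.
have -> : 0%:M = 0 :> 'M[R]_1 by rewrite raddf0.
by rewrite -scalar_mx_block.
Qed.

Lemma sub_col_mx2 e f v :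
  (v <= col_mx e f)%MS <-> exists x y, v = x *: e + y *: f.
Proof.
split=> [/submxP[D ->]|[x [y ->]]].
  rewrite -(hsubmxK (D : 'M[R]_(1, 1 + 1))) mul_row_col.
  exists (lsubmx (D : 'M[R]_(1, 1 + 1)) 0 0), (rsubmx (D : 'M[R]_(1, 1 + 1)) 0 0).
  by rewrite [X in X *m _ + _]mx11_scalar [X in _ + X *m _]mx11_scalar !mul_scalar_mx.
by rewrite -!mul_scalar_mx -mul_row_col submxMl.
Qed.

(** The orthogonal complement of [e] has codimension at most one, so it meets a space of rank at
    least two in a nonzero vector, which is then normalized. *)
Lemma orthogonal_unit_vector m (W : 'M[R]_(m, d)) e : (1 < \rank W)%N ->
  exists f, [/\ (f <= W)%MS, dotp f f = 1 & dotp e f = 0].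
Proof.
move=> rW; have : (W :&: kermx e^T)%MS != 0.
  rewrite -mxrank_eq0 -lt0n.
  have := mxrank_sum_cap W (kermx e^T); rewrite mxrank_ker.
  have := rank_leq_col (W + kermx e^T)%MS; have := rank_leq_col e^T.
  have := rank_leq_col W; lia.
case/rowV0Pn => v; rewrite sub_capmx => /andP[vW /sub_kermxP].
rewrite mulmx_trE => /matrixP/(_ 0 0); rewrite !mxE eqxx mulr1n => ve v0.
have n0 : euclid_norm v != 0 by apply: contraNneq v0 => /euclid_norm_eq0 ->.
exists ((euclid_norm v)^-1 *: v); split.
- exact: scalemx_sub.
- by rewrite dotpZl dotpZr -euclid_norm_sqr; field.
- by rewrite dotpZr dotpC ve mulr0.
Qed.

Lemma plane_basis (W : 'M[R]_(2, d)) e : \rank W = 2%N -> (e <= W)%MS ->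
  dotp e e = 1 -> exists f, orthonormal2 e f /\
    forall v, (v <= W)%MS -> exists x y, v = x *: e + y *: f.
Proof.
move=> rW eW ee; have [|f [fW ff ef]] := @orthogonal_unit_vector _ W e.
  by rewrite rW.
exists f; split=> // v vW; apply/sub_col_mx2; apply: submx_trans vW _.
have sub : (col_mx e f <= W)%MS by rewrite col_mx_sub eW.
by rewrite -(mxrank_leqif_sup sub) rW orthonormal2_rank.
Qed.

Lemma coplanar_segments e f (A0 B0 A1 B1 : 'rV[R]_d) : orthonormal2 e f ->
  (exists x y, B0 - A0 = x *: e + y *: f) ->
  (exists x y, B1 - A1 = x *: e + y *: f) ->
  (exists x y, B1 - B0 = x *: e + y *: f) ->
  coplanar [set A0; B0; A1; B1].
Proof.
move=> ef /sub_col_mx2 h0 /sub_col_mx2 h1 /sub_col_mx2 h2.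
exists A0, (col_mx e f : 'M[R]_(2, d)); split; first exact: orthonormal2_rank.
have hB1 : (B1 - A0 <= col_mx e f)%MS.
  by rewrite -(subrKA B0) addmx_sub.
move=> X [[[->|->]|->]|->] //.
- by rewrite subrr sub0mx.
- have -> : A1 - A0 = (B1 - A0) - (B1 - A1) by apply/rowP => i; rewrite !mxE; ring.
  by rewrite addmx_sub// eqmx_opp.
Qed.

Lemma dotp_orthonormal2 e f (x y x' y' : R) : orthonormal2 e f ->
  dotp (x *: e + y *: f) (x' *: e + y' *: f) = x * x' + y * y'.
Proof. by case=> ee ff ef; rewrite !dotpE ee ff ef (dotpC f) ef; ring. Qed.

End Planes.

(** * Necessity: coplanarity and the two distance bounds *)

Section TightBounds.
Variables (R : realType) (d : nat).

Section Bound.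
Variables (A B : R -> 'rV[R]_d) (phi : R -> R) (th : R) (e1 e2 : 'rV[R]_d).
Hypothesis tight : tight_motion A B phi th.
Hypothesis onb : orthonormal2 e1 e2.
Hypothesis DE : forall t, 0 <= t <= 1 ->
  B t - A t = cos (phi t) *: e1 + sin (phi t) *: e2.

(** Since [dotp U D] is the cosine of [phi - psi], it increases until [phi] reaches [psi] and
    decreases afterwards. On each phase [tight_forward] and [tight_backward] fix the signs of the
    displacements of [B] and [A] along [U]. *)
Lemma tight_support psi : 0 <= psi <= pi ->
  -1 <= dotp (cos psi *: e1 + sin psi *: e2) (B 1 - A 0) <= 1.
Proof.
move=> /andP[psi0 psipi]; set U := _ + _.
have UD t : 0 <= t <= 1 -> dotp U (B t - A t) = cos (phi t - psi).
  by move=> t01; rewrite DE// dotp_orthonormal2// cosB; ring.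
clearbody U.
have thpi := tight_le_pi tight.
have up s t : 0 <= s -> s <= t -> t <= 1 -> phi t <= psi ->
    forall x y, s <= x -> x <= y -> y <= t ->
    dotp U (B x - A x) <= dotp U (B y - A y).
  move=> s0 st t1 tpsi x y sx xy yt; rewrite !UD; [|apply/andP; lra..].
  have h1 := tight_angle_le tight (le_trans s0 sx) xy (le_trans yt t1).
  have h2 := tight_angle_le tight (le_trans s0 (le_trans sx xy)) yt t1.
  have /andP[h3 _] : 0 <= phi x <= th by apply: (tight_angle_itv tight); lra.
  by rewrite -[cos (phi x - _)]cosN -[cos (phi y - _)]cosN; apply: le_cos; lra.
have down s t : 0 <= s -> s <= t -> t <= 1 -> psi <= phi s ->
    forall x y, s <= x -> x <= y -> y <= t ->
    dotp (- U) (B x - A x) <= dotp (- U) (B y - A y).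
  move=> s0 st t1 tpsi x y sx xy yt; rewrite !dotpNl lerN2 !UD; [|apply/andP; lra..].
  have h1 := tight_angle_le tight (le_trans s0 sx) xy (le_trans yt t1).
  have h2 := tight_angle_le tight s0 sx (le_trans xy (le_trans yt t1)).
  have /andP[_ h3] : 0 <= phi y <= th by apply: (tight_angle_itv tight); lra.
  by apply: le_cos; lra.
have U0 : dotp U (B 0 - A 0) = cos psi.
  by rewrite UD ?(tight_start tight) ?sub0r ?cosN// lexx ler01.
have U1 : dotp U (B 1 - A 1) = cos (th - psi).
  by rewrite UD ?(tight_end tight)// lexx ler01.
have [psith|thpsi] := leP psi th.
  have [s /andP[s0 s1] phis] := tight_angle_onto tight psi0 psith.
  have Us : dotp U (B s - A s) = 1 by rewrite UD ?s0// phis subrr cos0.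
  have psi_phi : psi <= phi s by rewrite phis.
  have phi_psi : phi s <= psi by rewrite phis.
  have i1 := tight_forward tight s0 s1 (lexx 1) (down _ _ s0 s1 (lexx _) psi_phi).
  have i2 := tight_backward tight s0 s1 (lexx 1) (down _ _ s0 s1 (lexx _) psi_phi).
  have i3 := tight_forward tight (lexx 0) s0 s1 (up _ _ (lexx _) s0 s1 phi_psi).
  have i4 := tight_backward tight (lexx 0) s0 s1 (up _ _ (lexx _) s0 s1 phi_psi).
  (* The upper bound is [dotp U (B s - A s) = 1]; the lower bound obtained is [-1] plus this sum of
     cosines, whose sign comes from [th <= pi]. *)
  have cc : 0 <= cos psi + cos (th - psi).
    have : cos (pi - psi) <= cos (th - psi) by apply: le_cos; lra.
    by rewrite cosB cospi sinpi; lra.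
  move: U0 U1 Us i1 i2 i3 i4; rewrite !dotpE; move=> *; apply/andP; lra.
(* The angle [psi] is never passed, so the increasing phase is the whole motion. *)
have phi1 : phi 1 <= psi by rewrite (tight_end tight) ltW.
have i1 := tight_forward tight (lexx 0) ler01 (lexx 1) (up _ _ (lexx _) ler01 (lexx _) phi1).
have i2 := tight_backward tight (lexx 0) ler01 (lexx 1) (up _ _ (lexx _) ler01 (lexx _) phi1).
have c1 := cos_le1 (th - psi); have c0 := cos_geN1 psi.
move: U0 U1 i1 i2; rewrite !dotpE; move=> *; apply/andP; lra.
Qed.

Lemma tight_dist_le1 : euclid_dist (A 0) (B 1) <= 1.
Proof.
have [x [y E]] : exists x y, B 1 - A 0 = x *: e1 + y *: e2.
  case: onb => e11 e22 e12.
  have [x [y E]] := tight_displacement_planar tight e11 e22 e12 DE.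
  have D0 : B 0 - A 0 = cos (phi 0) *: e1 + sin (phi 0) *: e2.
    by apply: DE; rewrite lexx ler01.
  exists (x + cos (phi 0)), (y + sin (phi 0)).
  by rewrite -(subrKA (B 0)) E D0 !scalerDl addrACA.
rewrite /euclid_dist; set r := euclid_norm _.
have r0 : 0 <= r by exact: euclid_norm_ge0.
have rE : r ^+ 2 = x ^+ 2 + y ^+ 2.
  by rewrite euclid_norm_sqr E dotp_orthonormal2// !expr2.
have [->|rn0] := eqVneq r 0; first exact: ler01.
have {}r0 : 0 < r by rewrite lt_neqAle eq_sym rn0.
(* [tight_support] covers only directions with nonnegative sine, so the unit vector along
   [B 1 - A 0] is negated when it points into the lower half-plane. The two-sided bound makes the
   sign harmless. *)
pose sg : R := if 0 <= y then 1 else -1.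
have sg2 : sg ^+ 2 = 1 by rewrite /sg; case: ifP => _; ring.
have sgy : 0 <= sg * y.
  by rewrite /sg; case: ifP => [|/negbT]; rewrite -?ltNge => h; lra.
have itv : -1 <= sg * x / r <= 1.
  rewrite -ler_norml -ler_sqr ?nnegrE// real_normK ?num_real// expr1n.
  by rewrite expr_div_n ler_pdivrMr ?exprn_gt0// mul1r rE exprMn sg2; nra.
pose psi := acos (sg * x / r).
have cpsi : cos psi = sg * x / r by rewrite acosK// in_itv.
have spsi : sin psi = sg * y / r.
  rewrite sin_acos// -[RHS]ger0_norm; last by rewrite divr_ge0// ltW.
  rewrite -sqrtr_sqr; congr Num.sqrt; rewrite !expr_div_n !exprMn sg2 !mul1r.
  have -> : y ^+ 2 = r ^+ 2 - x ^+ 2 by rewrite rE; ring.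
  by field.
have psi_itv : 0 <= psi <= pi by rewrite /psi acos_ge0// acos_lepi.
have := tight_support psi_itv.
rewrite E dotp_orthonormal2// cpsi spsi.
have -> : sg * x / r * x + sg * y / r * y = sg * r.
  have -> : sg * x / r * x + sg * y / r * y = sg * (x ^+ 2 + y ^+ 2) / r by field.
  by rewrite -rE; field.
by rewrite /sg; case: ifP => _ h; lra.
Qed.

End Bound.

Lemma tight_motion_coplanar (A B : R -> 'rV[R]_d) phi th : (1 < d)%N -> 0 <= th ->
  tight_motion A B phi th ->
  [/\ coplanar [set A 0; B 0; A 1; B 1], euclid_dist (A 0) (B 1) <= 1
    & euclid_dist (A 1) (B 0) <= 1].
Proof.
move=> d1 th0 tight.
have unitD t : 0 <= t <= 1 -> dotp (B t - A t) (B t - A t) = 1.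
  by move=> /andP[t0 t1]; exact: tight_dir_sqr tight _ t0 t1.
have Z01 : (0 : R) <= (0 : R) <= 1 by rewrite lexx ler01.
have I01 : (0 : R) <= (1 : R) <= 1 by rewrite lexx ler01.
move: th0; rewrite le_eqVlt => /predU1P[th0|th0].
  have sp := tight_speed tight (lexx 0) ler01 (lexx 1).
  rewrite (tight_end tight) (tight_start tight) -th0 subrr in sp.
  have a0 := euclid_norm_ge0 (A 1 - A 0); have b0 := euclid_norm_ge0 (B 1 - B 0).
  have /eqP : A 1 - A 0 = 0 by apply: euclid_norm_eq0; lra.
  rewrite subr_eq0 => /eqP AE.
  have /eqP : B 1 - B 0 = 0 by apply: euclid_norm_eq0; lra.
  rewrite subr_eq0 => /eqP BE.
  (* With [th = 0] the motion ends where it began, and all points lie on one line; any unit vector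
     orthogonal to it completes a plane, which is where [1 < d] enters. *)
  have [|f [_ ff ef]] := @orthogonal_unit_vector R d d 1%:M (B 0 - A 0).
    by rewrite mxrank1.
  have ue : dotp (B 0 - A 0) (B 0 - A 0) = 1 by exact: unitD.
  have le1 : euclid_norm (B 0 - A 0) <= 1 by rewrite euclid_norm_le// ue expr1n.
  rewrite /euclid_dist AE BE; split => //.
  apply: (@coplanar_segments _ _ (B 0 - A 0) f); first by split.
  - by exists 1, 0; rewrite scale1r scale0r addr0.
  - by exists 1, 0; rewrite scale1r scale0r addr0.
  - by exists 0, 0; rewrite subrr !scale0r addr0.
have [e1 [e2 [e11 e22 e12 DE]]] := tight_planar tight th0.
have onb : orthonormal2 e1 e2 by split.
split.
- apply: (coplanar_segments onb).
  + by exists (cos (phi 0)), (sin (phi 0)); exact: DE.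
  + by exists (cos (phi 1)), (sin (phi 1)); exact: DE.
  + exact: (tight_displacement_planar tight).
- exact: (tight_dist_le1 tight onb DE).
- rewrite /euclid_dist -opprB euclid_normN.
  have onbN : orthonormal2 (- e1) (- e2).
    by split; rewrite dotpNl dotpNr opprK.
  apply: (tight_dist_le1 (tight_motion_swap tight) onbN) => t t01.
  by rewrite -opprB DE// !scalerN opprD.
Qed.

End TightBounds.

(** * Sufficiency: explicit motions reaching every point of the lens *)

Section Construction.
Variables (R : realType) (d : nat).
Implicit Types (f v : 'rV[R]_d).

Lemma norm_le_euclid_norm v : `|v| <= euclid_norm v.
Proof.
rewrite [leLHS]/Num.norm/= mx_normrE; apply: bigmax_le => [|[i j] _] /=.
  exact: euclid_norm_ge0.
rewrite -ler_sqr ?nnegrE ?euclid_norm_ge0// euclid_norm_sqr real_normK ?num_real//.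
rewrite (ord1 i) /dotp (bigD1 j)//= -expr2 lerDl.
by apply: sumr_ge0 => k _; rewrite -expr2 sqr_ge0.
Qed.

Lemma lipschitz_within_continuous (f : R -> 'rV[R]_d) (K : R) :
  (forall s t, 0 <= s -> s <= t -> t <= 1 ->
    euclid_dist (f s) (f t) <= K * (t - s)) ->
  {within `[0, 1], continuous f}.
Proof.
move=> lip.
have lip' s t : 0 <= s <= 1 -> 0 <= t <= 1 -> euclid_norm (f s - f t) <= `|K| * `|s - t|.
  move=> /andP[s0 s1] /andP[t0 t1]; rewrite -normrM.
  have [st|ts] := leP s t.
    rewrite -opprB euclid_normN -normrN -mulrN opprB.
    by apply: le_trans (lip _ _ s0 st t1) _; exact: ler_norm.
  by apply: le_trans (lip _ _ t0 (ltW ts) s1) _; exact: ler_norm.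
apply/subspace_continuousP => x; rewrite /= in_itv/= => x01.
apply/cvgrPdist_lt => e e0; rewrite near_withinE.
have k0 : 0 < e / (`|K| + 1) by rewrite divr_gt0// ltr_wpDl.
exists (e / (`|K| + 1)) => //= t /=; rewrite in_itv/= => xt t01.
apply: le_lt_trans (norm_le_euclid_norm _) _.
apply: le_lt_trans (lip' _ _ x01 t01) _.
move: xt; rewrite ltr_pdivlMr; last by rewrite ltr_wpDl.
by have := normr_ge0 (x - t); have := normr_ge0 K; nra.
Qed.

Definition circle (f1 f2 : 'rV[R]_d) (x : R) : 'rV[R]_d := cos x *: f1 + sin x *: f2.

Lemma dotp_circle f1 f2 x y : orthonormal2 f1 f2 ->
  dotp (circle f1 f2 x) (circle f1 f2 y) = cos (x - y).
Proof. by move=> onb; rewrite dotp_orthonormal2// cosB. Qed.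

Lemma circle_dist f1 f2 x y : orthonormal2 f1 f2 -> x <= y ->
  euclid_norm (circle f1 f2 y - circle f1 f2 x) <= y - x.
Proof.
move=> onb xy; rewrite euclid_norm_le ?subr_ge0// dotp_sqrB !dotp_circle//.
rewrite !subrr cos0; have := cos_ge_quadratic (y - x); lra.
Qed.

(** Splits a turn at a threshold angle into the part below and the part above, each carried by one
    endpoint. *)
Lemma min_max_addE (V : zmodType) (g : R -> V) x y :
  g (Num.min x y) + g (Num.max x y) = g x + g y.
Proof. by case: (leP x y) => _ //; rewrite addrC. Qed.

Lemma le_min2r (x y z : R) : x <= y -> Num.min x z <= Num.min y z.
Proof. by move=> xy; rewrite le_min ge_min xy ge_min lexx orbT. Qed.

Lemma le_max2r (x y z : R) : x <= y -> Num.max x z <= Num.max y z.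
Proof. by move=> xy; rewrite ge_max le_max xy le_max lexx orbT. Qed.

Section Motion.
Variables (f1 f2 A0 : 'rV[R]_d) (al be c : R).
Hypothesis onb : orthonormal2 f1 f2.
Hypothesis al_itv : 0 <= al <= pi / 2.
Hypothesis be_itv : - al <= be <= al.
Hypothesis c_itv : 0 <= c <= 1.

Let u := circle f1 f2.
(** The direction turns from [- al] to [al], so [f1] points along the bisector of the initial and
    final directions. *)
Let ph (t : R) := 2 * al * t - al.

(* A convex combination, with common direction [u (ph t)], of two motions: in the
   first the segment turns about [A] until its angle is [be], then about [B]; in
   the second it turns about [B] until its angle is [- be], then about [A]. *)
Definition lensA t := A0 + (1 - c) *: (u be - u (Num.max (ph t) be)) +
  c *: (u (- al) - u (Num.min (ph t) (- be))).
Definition lensB t := A0 + (1 - c) *: u (Num.min (ph t) be) +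
  c *: (u (- al) - u (- be) + u (Num.max (ph t) (- be))).

(** Weighted swept angles: their increments dominate the chords of [lensA] and [lensB], and together
    they equal the increment of [ph]. *)
Let gA t := (1 - c) * Num.max (ph t) be + c * Num.min (ph t) (- be).
Let gB t := (1 - c) * Num.min (ph t) be + c * Num.max (ph t) (- be).

Lemma lens_dir t : lensB t - lensA t = u (ph t).
Proof.
have maxE z : u (Num.max (ph t) z) = u (ph t) + u z - u (Num.min (ph t) z).
  by rewrite -min_max_addE addrAC subrr add0r.
rewrite /lensA /lensB !maxE; clearbody u.
by apply/rowP => i; rewrite !mxE; ring.
Qed.

Lemma ph_le s t : s <= t -> ph s <= ph t.
Proof. by move=> st; rewrite /ph; have /andP[] := al_itv; nra. Qed.

Lemma norm_convex (v w : 'rV[R]_d) : euclid_norm ((1 - c) *: v + c *: w) <=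
  (1 - c) * euclid_norm v + c * euclid_norm w.
Proof.
have /andP[c0 c1] := c_itv; apply: le_trans (euclid_normD _ _) _.
by rewrite !euclid_normZ !ger0_norm// subr_ge0.
Qed.

Lemma lensA_dist s t : s <= t -> euclid_dist (lensA s) (lensA t) <= gA t - gA s.
Proof.
move=> st; have pst := ph_le st; rewrite /euclid_dist.
rewrite -opprB euclid_normN.
have -> : lensA s - lensA t = (1 - c) *: (u (Num.max (ph t) be) - u (Num.max (ph s) be)) +
    c *: (u (Num.min (ph t) (- be)) - u (Num.min (ph s) (- be))).
  by rewrite /lensA; clearbody u; apply/rowP => i; rewrite !mxE; ring.
apply: le_trans (norm_convex _ _) _.
have h1 := circle_dist onb (le_max2r be pst).
have h2 := circle_dist onb (le_min2r (- be) pst).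
have /andP[c0 c1] := c_itv; rewrite -subr_ge0 in c1.
have := lerD (ler_wpM2l c1 h1) (ler_wpM2l c0 h2); rewrite /gA -/u; lra.
Qed.

Lemma lensB_dist s t : s <= t -> euclid_dist (lensB s) (lensB t) <= gB t - gB s.
Proof.
move=> st; have pst := ph_le st; rewrite /euclid_dist.
have -> : lensB t - lensB s = (1 - c) *: (u (Num.min (ph t) be) - u (Num.min (ph s) be)) +
    c *: (u (Num.max (ph t) (- be)) - u (Num.max (ph s) (- be))).
  by rewrite /lensB; clearbody u; apply/rowP => i; rewrite !mxE; ring.
apply: le_trans (norm_convex _ _) _.
have h1 := circle_dist onb (le_min2r be pst).
have h2 := circle_dist onb (le_max2r (- be) pst).
have /andP[c0 c1] := c_itv; rewrite -subr_ge0 in c1.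
have := lerD (ler_wpM2l c1 h1) (ler_wpM2l c0 h2); rewrite /gB -/u; lra.
Qed.

Lemma lens_gauge t : gA t + gB t = ph t + (1 - 2 * c) * be.
Proof.
have maxE z : Num.max (ph t) z = ph t + z - Num.min (ph t) z.
  by have := min_max_addE id (ph t) z; rewrite /=; lra.
by rewrite /gA /gB !maxE; ring.
Qed.

Lemma lensA_continuous : {within `[0, 1], continuous lensA}.
Proof.
apply: (@lipschitz_within_continuous _ (2 * al)) => s t s0 st t1.
apply: le_trans (lensA_dist st) _.
(* The increment of [gB] is nonnegative, so that of [gA] is at most the increment of [ph], which is
   [2 * al * (t - s)]. *)
have := le_trans (euclid_norm_ge0 _) (lensB_dist st).
have := lens_gauge t; have := lens_gauge s; rewrite /ph; nra.
Qed.

Lemma lensB_continuous : {within `[0, 1], continuous lensB}.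
Proof.
apply: (@lipschitz_within_continuous _ (2 * al)) => s t s0 st t1.
apply: le_trans (lensB_dist st) _.
have := le_trans (euclid_norm_ge0 _) (lensA_dist st).
have := lens_gauge t; have := lens_gauge s; rewrite /ph; nra.
Qed.

Lemma lens_start : lensA 0 = A0 /\ lensB 0 = A0 + u (- al).
Proof.
have /andP[be0 be1] := be_itv.
have ph0 : ph 0 = - al by rewrite /ph mulr0 sub0r.
rewrite /lensA /lensB ph0 max_r// min_l ?lerN2// min_l// max_r ?lerN2//.
by clearbody u; split; apply/rowP => i; rewrite !mxE; ring.
Qed.

(** As [c] goes from [0] to [1], this point crosses the lens at height [sin be], from the unit
    circle about [A0] to the unit circle about [A0 + (2 * cos al) *: f1]. *)
Lemma lens_end : lensB 1 = A0 + ((1 - c) * cos be + c * (2 * cos al - cos be)) *: f1 +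
  sin be *: f2.
Proof.
have /andP[be0 be1] := be_itv.
have ph1 : ph 1 = al by rewrite /ph; ring.
rewrite /lensB ph1 min_r// max_l; last by lra.
by rewrite /u /circle !cosN !sinN; apply/rowP => i; rewrite !mxE; ring.
Qed.

Lemma lens_length :
  (curve_length 0 1 lensA + curve_length 0 1 lensB <= (2 * al)%:E)%E.
Proof.
have -> : 2 * al = (gA 1 - gA 0) + (gB 1 - gB 0).
  by have := lens_gauge 1; have := lens_gauge 0; rewrite /ph; lra.
rewrite EFinD; apply: leeD; apply: curve_length_le ler01 _ => s t _ st _.
  exact: lensA_dist.
exact: lensB_dist.
Qed.

End Motion.

(* [(x, y)] lies in the intersection of the unit discs centred at [0] and at
   [(2 cos al, 0)]; it divides a horizontal chord of this lens in the ratio [c]. *)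
Lemma lens_chord (al x y : R) : 0 <= al <= pi / 2 ->
  x ^+ 2 + y ^+ 2 <= 1 -> (x - 2 * cos al) ^+ 2 + y ^+ 2 <= 1 ->
  exists be c, [/\ - al <= be <= al, 0 <= c <= 1, sin be = y &
    (1 - c) * cos be + c * (2 * cos al - cos be) = x].
Proof.
move=> /andP[al0 alpi] h1 h2.
have ca : 0 <= cos al by apply: cos_ge0_pihalf; apply/andP; have := pi_gt0 R; lra.
have y2 : y ^+ 2 <= 1 by nra.
have y1 : -1 <= y <= 1 by rewrite -ler_norml -ler_sqr ?nnegrE// real_normK ?num_real// expr1n.
(* At height [y] the chord of the lens runs from [2 * cos al - cos be] to [cos be]. Since it
   contains [x], [cos al <= cos be], which confines [be] to [[- al, al]]. *)
pose be := asin y; have sb : sin be = y by rewrite asinK// in_itv.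
have cb : cos be = Num.sqrt (1 - y ^+ 2) by rewrite cos_asin.
have cb0 : 0 <= cos be by rewrite cb sqrtr_ge0.
have cb2 : cos be ^+ 2 = 1 - y ^+ 2 by rewrite cb sqr_sqrtr// subr_ge0.
have xk : x <= cos be by apply: contraTT h1; rewrite -!ltNge => h; nra.
have xk' : 2 * cos al - x <= cos be by apply: contraTT h2; rewrite -!ltNge => h; nra.
have cacb : cos al <= cos be by lra.
have be1 : - (pi / 2) <= be by rewrite asin_geNpi2.
have be2 : be <= pi / 2 by rewrite asin_lepi2.
have pi0 := pi_gt0 R.
have bal : - al <= be <= al.
  rewrite -ler_norml leNgt; apply/negP => lt_al.
  have nbpi : `|be| <= pi by rewrite ler_norml; lra.
  have : cos `|be| < cos al.
    by rewrite ltr_cos// in_itv/= ?normr_ge0 ?al0 ?nbpi//=; lra.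
  have -> : cos `|be| = cos be by case: (ger0P be) => _; rewrite ?cosN.
  by rewrite ltNge cacb.
(* If the cosines agree, the chord is a single point and [c = 0] serves; otherwise [c] solves a
   linear equation. *)
have [eq_c|neq_c] := eqVneq (cos al) (cos be).
  exists be, 0; split=> //; first by rewrite lexx ler01.
  by rewrite subr0 !mul0r mul1r addr0; lra.
have gap : 0 < cos be - cos al by rewrite subr_gt0 lt_neqAle neq_c.
exists be, ((cos be - x) / (2 * (cos be - cos al))); split=> //.
  by apply/andP; split; [apply: divr_ge0; lra|rewrite ler_pdivrMr; lra].
by field; rewrite gt_eqF.
Qed.

(** A frame starting with [D0] is rotated by [th / 2], so that [f1] bisects the angle and the two
    directions become symmetric. *)
Lemma bisector_basis (W : 'M[R]_(2, d)) (D0 D1 : 'rV[R]_d) (th : R) :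
  \rank W = 2%N -> (D0 <= W)%MS -> (D1 <= W)%MS ->
  dotp D0 D0 = 1 -> dotp D1 D1 = 1 -> dotp D0 D1 = cos th ->
  exists f1 f2, [/\ orthonormal2 f1 f2, D0 = circle f1 f2 (- (th / 2)),
    D1 = circle f1 f2 (th / 2) &
    forall v, (v <= W)%MS -> exists x y, v = x *: f1 + y *: f2].
Proof.
move=> rW D0W D1W D00 D11 D01.
have [e [onb span]] := plane_basis rW D0W D00.
have [x [y D1E]] := span _ D1W.
have [D00' ee De] := onb.
have xE : x = cos th by rewrite -D01 D1E dotpDr !dotpZr D00 De mulr1 mulr0 addr0.
have y2 : y ^+ 2 = sin th ^+ 2.
  have := D11; rewrite D1E dotp_orthonormal2// xE; have := cos2Dsin2 th; lra.
have [e' [onb' D1E' span']] : exists e', [/\ orthonormal2 D0 e',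
    D1 = cos th *: D0 + sin th *: e' &
    forall v, (v <= W)%MS -> exists x y, v = x *: D0 + y *: e'].
  (* The second coordinate of [D1] is known only up to sign; replacing [e] by [- e] makes it
     [sin th]. *)
  move/eqP: y2; rewrite eqf_sqr => /orP[] /eqP yE.
    by exists e; split => //; rewrite D1E xE yE.
  exists (- e); split.
  - by split; rewrite ?dotpNl ?dotpNr ?opprK ?De ?oppr0.
  - by rewrite D1E xE yE scalerN scaleNr.
  - by move=> v /span[p [q ->]]; exists p, (- q); rewrite scalerN scaleNr opprK.
have cs := cos2Dsin2 (th / 2).
pose f1 := cos (th / 2) *: D0 + sin (th / 2) *: e'.
pose f2 := - sin (th / 2) *: D0 + cos (th / 2) *: e'.
have D0E : D0 = cos (th / 2) *: f1 - sin (th / 2) *: f2.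
  rewrite /f1 /f2 !scalerDr !scalerA opprD addrACA -scalerBl -scalerBl.
  rewrite [X in X *: e'](_ : _ = 0); last by ring.
  by rewrite scale0r addr0 -[LHS]scale1r; congr (_ *: _); rewrite -[LHS]cs; ring.
have e'E : e' = sin (th / 2) *: f1 + cos (th / 2) *: f2.
  rewrite /f1 /f2 !scalerDr !scalerA addrACA -scalerDl -scalerDl.
  rewrite [X in X *: D0](_ : _ = 0); last by ring.
  by rewrite scale0r add0r -[LHS]scale1r; congr (_ *: _); rewrite -[LHS]cs; ring.
have h11 : dotp f1 f1 = 1 by rewrite dotp_orthonormal2// -[RHS]cs; ring.
have h22 : dotp f2 f2 = 1 by rewrite dotp_orthonormal2// -[RHS]cs; ring.
have h12 : dotp f1 f2 = 0 by rewrite dotp_orthonormal2//; ring.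
exists f1, f2; split.
- by split.
- by rewrite /circle cosN sinN scaleNr.
- have cE : cos th = _ := etrans (congr1 cos (splitr th)) (cosD _ _).
  have sE : sin th = _ := etrans (congr1 sin (splitr th)) (sinD _ _).
  rewrite /circle D1E' cE sE /f1 /f2.
  rewrite !scalerDr !scalerA addrACA -!scalerDl.
  by congr (_ *: _ + _ *: _); ring.
- move=> v /span'[p [q ->]]; exists (p * cos (th / 2) + q * sin (th / 2)).
  exists (q * cos (th / 2) - p * sin (th / 2)).
  clearbody f1 f2; rewrite {1}D0E {1}e'E.
  by apply/rowP => i; rewrite !mxE; ring.
Qed.

End Construction.

(** * The motion for given segments, and the equivalence *)

Section LensMotion.
Variables (R : realType) (d : nat).

Lemma lens_motion_exists (A0 B0 A1 B1 : 'rV[R]_d) (th : R) :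
  euclid_dist A0 B0 = 1 -> euclid_dist A1 B1 = 1 ->
  th = vangle (B0 - A0) (B1 - A1) ->
  coplanar [set A0; B0; A1; B1] -> euclid_dist A0 B1 <= 1 ->
  euclid_dist A1 B0 <= 1 ->
  exists A B : R -> 'rV[R]_d,
    rigid_motion A0 B0 A1 B1 A B /\ motion_length A B = th%:E.
Proof.
move=> unit0 unit1 thE [p [W [rW inW]]] le01 le10.
have inW2 X Y : [set A0; B0; A1; B1] X -> [set A0; B0; A1; B1] Y -> (Y - X <= W)%MS.
  move=> /inW hX /inW hY.
  have -> : Y - X = (Y - p) - (X - p) by apply/rowP => i; rewrite !mxE; ring.
  by rewrite addmx_sub// eqmx_opp.
have D0W : (B0 - A0 <= W)%MS by apply: inW2; rewrite /=; tauto.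
have D1W : (B1 - A1 <= W)%MS by apply: inW2; rewrite /=; tauto.
have wW : (B1 - A0 <= W)%MS by apply: inW2; rewrite /=; tauto.
have D01 : dotp (B0 - A0) (B1 - A1) = cos th by rewrite thE cos_vangle.
have /andP[th0 thpi] : 0 <= th <= pi by rewrite thE vangle_itv.
have [f1 [f2 [onb D0E D1E span]]] :=
  bisector_basis rW D0W D1W (dotp_unit unit0) (dotp_unit unit1) D01.
have [x [y wE]] := span _ wW.
have h1 : x ^+ 2 + y ^+ 2 <= 1.
  move: le01; rewrite /euclid_dist euclid_norm_le// wE dotp_orthonormal2// expr1n.
  by rewrite !expr2.
have h2 : (x - 2 * cos (th / 2)) ^+ 2 + y ^+ 2 <= 1.
  move: le10; rewrite /euclid_dist.
  have -> : B0 - A1 = (2 * cos (th / 2) - x) *: f1 + (- y) *: f2.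
    (* This identity turns the bound on the distance from [A1] to [B0] into the unit disc centred at
       the sum of the two directions, [2 * cos (th / 2)] times [f1]. *)
    have -> : B0 - A1 = (B0 - A0) + (B1 - A1) - (B1 - A0).
      by apply/rowP => i; rewrite !mxE; ring.
    rewrite wE D0E D1E /circle cosN sinN.
    by apply/rowP => i; rewrite !mxE; ring.
  rewrite euclid_norm_le// dotp_orthonormal2// expr1n => h.
  by apply: le_trans h; rewrite le_eqVlt; apply/orP; left; apply/eqP; ring.
have al_itv : 0 <= th / 2 <= pi / 2 by lra.
have [be [c [be_itv c_itv sb xE]]] := lens_chord al_itv h1 h2.
pose A := lensA f1 f2 A0 (th / 2) be c; pose B := lensB f1 f2 A0 (th / 2) be c.
have dir t : B t - A t = circle f1 f2 (2 * (th / 2) * t - th / 2).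
  exact: lens_dir.
have unitD t : euclid_norm (B t - A t) = 1.
  by rewrite dir /euclid_norm dotp_circle// subrr cos0 sqrtr1.
have [startA startB] := lens_start f1 f2 A0 c be_itv.
rewrite -D0E addrC subrK -/A -/B in startA startB.
have endB : B 1 = B1.
  by rewrite /B lens_end// xE sb -addrA -wE addrC subrK.
have endA : A 1 = A1.
  have := dir 1; rewrite (_ : _ * 1 - _ = th / 2); last by field.
  by rewrite -D1E endB => /addrI/oppr_inj.
have cA : {within `[0, 1], continuous A} by exact: lensA_continuous.
have cB : {within `[0, 1], continuous B} by exact: lensB_continuous.
exists A, B; split; first by split => // t _; exact: unitD.
apply/eqP; rewrite eq_le; apply/andP; split.
  have -> : th = 2 * (th / 2) by field.
  exact: lens_length.
(* The construction bounds the length only from above; equality comes from the lower bound valid for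
   every motion. *)
rewrite thE -startA -startB -endA -endB.
apply: vangle_le_pair_length => //.
exact: angle_continuous_motion.
Qed.

End LensMotion.

Theorem theorem3 (R : realType) (d : nat) (hd : (2 <= d)%N)
    (A0 B0 A1 B1 : 'rV[R]_d)
    (unit0 : euclid_dist A0 B0 = 1) (unit1 : euclid_dist A1 B1 = 1)
    (theta : R) (htheta : - pi < theta <= pi)
    (angle_theta : `|theta| = vangle (B0 - A0) (B1 - A1)) :
  (exists A B : R -> 'rV[R]_d,
     rigid_motion A0 B0 A1 B1 A B /\ motion_length A B = `|theta|%:E) <->
  [/\ coplanar [set A0; B0; A1; B1], euclid_dist A0 B1 <= 1 & euclid_dist A1 B0 <= 1].
Proof.
split=> [[A [B [[cA cB A0E B0E A1E B1E unitD] lenE]]]|[cop le01 le10]]; last first.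
  exact: lens_motion_exists.
rewrite -A0E -B0E -A1E -B1E in angle_theta *.
have tight := tight_motion_of_length cA cB unitD angle_theta lenE.
exact: tight_motion_coplanar tight.
Qed.
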